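(* Let $p$ be a prime and let $A,\Gamma\subset\mathbb{F}_p^*$ be two multiplicative subgroups with $|A|<\sqrt p$ and $|\Gamma|<p^{3/4}$. Suppose that $A'\subseteq A+s$ for some $s\in\mathbb{F}_p$, and that $A'-A'\subseteq\xi\Gamma\sqcup\{0\}$ for some $\xi\in\mathbb{F}_p^*$. Then $$|A'|^6\ll|A|^4|\Gamma|^{2/3}\log|A|.$$ In particular, if $A-A\subseteq\xi\Gamma\sqcup\{0\}$ then $|A|\ll|\Gamma|^{1/3}\log^{1/2}|\Gamma|$.
   Context: $X\ll Y$ means $X\le cY$ with an absolute constant $c>0$.
   Formalization: The formal theorem assumes additionally |A| ≥ 2 in both claims, since for |A| = 1 the factor log|A| vanishes and a one-element A' violates the first bound (and |A| = |Γ| = 1 violates the second). *)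

(* Defs.v *)
From HB Require Import structures.
From mathcomp Require Import all_boot all_order all_algebra all_fingroup.
From mathcomp Require Import all_classical all_reals all_analysis.
Set Implicit Arguments. Unset Strict Implicit. Unset Printing Implicit Defensive.
Import Order.TTheory GRing.Theory Num.Theory.
Local Open Scope ring_scope.

Definition elts (p : nat) (G : {group {unit 'F_p}}) : {set 'F_p} :=
  [set val g | g in G].

Definition translate (p : nat) (A : {set 'F_p}) (s : 'F_p) : {set 'F_p} :=
  [set a + s | a in A].

Definition diffset (p : nat) (A : {set 'F_p}) : {set 'F_p} :=
  [set x - y | x in A, y in A].

Definition dilate (p : nat) (xi : 'F_p) (G : {set 'F_p}) : {set 'F_p} :=
  [set xi * g | g in G].

(* Main.v *)
(** For distinct [a, b, c] in [A'] the ratio [x = (c - b) / (a - b)] and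
    [x - 1 = (c - a) / (a - b)] both lie in the subgroup [G], so [x] ranges over
    a set [X] with [#|X|^3 = O(#|G|^2)].  With [T = #|A|], the number of triples
    of ratio [x] is at most [T (nu x - 1)], where [nu x] counts the [y] with
    [y^T = x^T] and [(y - 1)^T = (x - 1)^T].  The weak-type estimate
    [t^2 #|{x | nu x > t}| = O(T^2)] bounds the sum of [nu x - 1] over [X] by
    [O(T #|X|^(1/2))], hence [#|A'|^3 = O(T^2 #|G|^(1/3))], and the logarithms of
    the theorem are only bounded from below.  Both estimates are instances of
    Stepanov's method for the points [x] whose pair [(x^T, (x - 1)^T)] belongs
    to a prescribed set of [J] pairs; there are [O((J T)^(2/3))] of them. *)
Require Import Defs.
From HB Require Import structures.
From mathcomp Require Import all_boot all_order all_algebra all_fingroup.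
From mathcomp Require Import cyclic zify ring.
Set Implicit Arguments. Unset Strict Implicit. Unset Printing Implicit Defensive.
Import Order.TTheory GRing.Theory Num.Theory.
Local Open Scope ring_scope.

(** * Polynomial and linear algebra preliminaries *)

Lemma mulX_derivXn (F : fieldType) (n : nat) :
  'X * ('X^n)^`() = n%:R *: 'X^n :> {poly F}.
Proof.
case: n => [|n]; first by rewrite expr0 -polyC1 derivC mulr0 scale0r.
by rewrite derivXn mulrnAr -exprS scaler_nat.
Qed.

Lemma dvdp_XsubC_exp_deriv (F : fieldType) (a : F) (n : nat) (f : {poly F}) :
  ('X - a%:P) ^+ n.+1 %| f -> ('X - a%:P) ^+ n %| f^`().
Proof.
move=> /dvdpP[q ->]; rewrite derivM deriv_exp derivXsubC mul1r /=.
by rewrite dvdp_add ?dvdp_mull ?exprS ?dvdp_mull // -mulr_natl dvdp_mull.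
Qed.

(* The operator [X d/dx - e_i] kills the i-th monomial and lowers the order
   of vanishing at 1 by at most one. *)
Lemma sparse_poly_eq0 (F : fieldType) (I : eqType) (e : I -> nat)
    (s : seq I) (c : I -> F) :
  uniq s -> {in s &, injective (fun i => (e i)%:R : F)} ->
  ('X - 1%:P) ^+ size s %| \sum_(i <- s) c i *: 'X^(e i) ->
  {in s, forall i, c i = 0}.
Proof.
elim: s c => [|i s IH] c //= /andP[nis us] inj dv.
have rest j : j \in s -> c j = 0.
  move=> js.
  have : c j * ((e j)%:R - (e i)%:R) = 0.
    apply: (IH (fun j => c j * ((e j)%:R - (e i)%:R)) us) => // [j1 j2 j1s j2s|].
      by apply: inj; rewrite inE ?j1s ?j2s orbT.
    set f := \sum_(_ <- _) _ in dv.
    have -> : \sum_(j <- s) (c j * ((e j)%:R - (e i)%:R)) *: 'X^(e j)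
              = 'X * f^`() - (e i)%:R *: f.
      rewrite /f !big_cons derivD derivZ mulrDr scalerDr -scalerAr mulX_derivXn.
      rewrite !scalerA [c i * _]mulrC opprD addrACA subrr add0r raddf_sum.
      rewrite mulr_sumr scaler_sumr -sumrB; apply: eq_bigr => k _.
      rewrite /= derivZ -scalerAr mulX_derivXn !scalerA -scalerBl mulrBr.
      by rewrite [_%:R * c k]mulrC.
    rewrite dvdp_sub ?dvdp_mull ?dvdp_XsubC_exp_deriv //.
    rewrite -mul_polyC dvdp_mull //; apply: dvdp_trans dv.
    by rewrite exprS dvdp_mull.
  move/eqP; rewrite mulf_eq0 subr_eq0 => /orP[/eqP //|/eqP eij].
  have ji : j = i by apply: inj eij; rewrite inE ?js ?eqxx ?orbT.
  by move: nis; rewrite -ji js.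
move=> j; rewrite inE => /predU1P[->|/rest //].
move: dv; rewrite big_cons big1_seq => [|k /andP[_ /rest ->]]; last by rewrite scale0r.
rewrite addr0 exprS => dv.
have : root (c i *: 'X^(e i)) 1.
  by rewrite -dvdp_XsubCl; apply: dvdp_trans dv; rewrite dvdp_mulr.
by rewrite rootE !hornerE expr1n mulr1 => /eqP.
Qed.

(** Uniqueness of a base-[g] expansion: modulo [g] only the lowest coefficient survives, so it
    vanishes; then [g] is cancelled and the argument repeats. *)
Lemma adic_sum_eq0 (F : fieldType) (g : {poly F}) (n : nat)
    (f : 'I_n -> {poly F}) :
  g != 0 -> (forall i, g %| f i -> f i = 0) ->
  \sum_(i < n) f i * g ^+ i = 0 -> forall i, f i = 0.
Proof.
move=> g0; elim: n f => [|n IH] f fdv; first by move=> _ [].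
rewrite big_ord_recl /= expr0 mulr1.
have -> : \sum_(i < n) f (lift ord0 i) * g ^+ bump 0 i
          = g * \sum_(i < n) f (lift ord0 i) * g ^+ i.
  by rewrite mulr_sumr; apply: eq_bigr => i _; rewrite /bump add1n exprS mulrCA.
set h := \sum_(i < n) _ => fg; have f0 : f ord0 = 0.
  apply: fdv; have : g %| f ord0 + g * h by rewrite fg dvdp0.
  by rewrite dvdp_addl ?dvdp_mulIl.
move: fg; rewrite f0 add0r => /eqP; rewrite mulf_eq0 (negPf g0) => /eqP h0 i.
case: (unliftP ord0 i) => [j|] -> //.
by apply: (IH (fun j => f (lift ord0 j))) h0 j => k; exact: fdv.
Qed.

(** The matrix of [M] has rank at most [#|E| < #|I|], so its left kernel contains a nonzero row. *)
Lemma underdetermined_system (F : fieldType) (I E : finType) (M : I -> E -> F) :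
  (#|E| < #|I|)%N ->
  exists l : I -> F, (exists i, l i != 0) /\ forall e, \sum_i l i * M i e = 0.
Proof.
move=> EI; pose A := \matrix_(i < #|I|, j < #|E|) M (enum_val i) (enum_val j).
have : kermx A != 0.
  rewrite kermx_eq0 /row_free neq_ltn; apply/orP; left.
  exact: leq_ltn_trans (rank_leq_col A) EI.
move=> /matrix0Pn[r [k rk0]].
exists (fun i => kermx A r (enum_rank i)); split.
  by exists (enum_val k); rewrite enum_valK.
move=> e; have /matrixP/(_ r (enum_rank e)) := mulmx_ker A.
rewrite mxE [RHS]mxE => Ae; rewrite -[RHS]Ae.
rewrite (reindex (fun i : 'I_#|I| => enum_val i)) /=; last first.
  by exists enum_rank => i _; rewrite ?enum_valK ?enum_rankK.
by apply: eq_bigr => i _; rewrite enum_valK [A _ _]mxE enum_rankK.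
Qed.

Lemma size_mul_le (R : nzRingType) (f g : {poly R}) (m n : nat) :
  (size f <= m.+1)%N -> (size g <= n)%N -> (size (f * g)%R <= m + n)%N.
Proof.
move=> fm gn; apply: leq_trans (size_mul_leq _ _) _.
by rewrite -subn1 leq_subLR add1n -addSn leq_add.
Qed.

Lemma dvdp_prod_XsubC_exp (F : fieldType) (s : seq F) (n : nat) (f : {poly F}) :
  uniq s -> {in s, forall x, ('X - x%:P) ^+ n %| f} ->
  (\prod_(x <- s) ('X - x%:P)) ^+ n %| f.
Proof.
elim: s => [|x s IH] /=; first by rewrite big_nil expr1n dvd1p.
move=> /andP[xs us] dv; rewrite big_cons exprMn Gauss_dvdp.
  rewrite dv ?mem_head // IH // => y ys.
  by apply: dv; rewrite inE ys orbT.
rewrite coprimep_sym coprimep_expl // coprimep_expr // coprimep_XsubC.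
by rewrite root_prod_XsubC.
Qed.

(** * The derivation [X (X - 1) d/dX] and orders of vanishing *)

Section Theta.
Variable F : fieldType.
Implicit Types (f q : {poly F}) (i j k n : nat).

(** The factor [X (X - 1)] makes [X^i (X - 1)^j] divide its own image, so high powers are never
    differentiated away; it is nonzero at the points [x] other than 0 and 1. *)
Definition theta f : {poly F} := 'X * ('X - 1%:P) * f^`().

(** This is [theta] conjugated by multiplication by [X^i (X - 1)^j]; the added term is the
    logarithmic derivative of that product times [X (X - 1)]. *)
Definition twisted_theta i j q : {poly F} :=
  theta q + (i%:R * ('X - 1%:P) + j%:R * 'X) * q.

Lemma iter_theta_sum (I : finType) (l : I -> F) (g : I -> {poly F}) n :
  iter n theta (\sum_i l i *: g i) = \sum_i l i *: iter n theta (g i).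
Proof.
elim: n => //= n ->; rewrite /theta raddf_sum mulr_sumr.
by apply: eq_bigr => i _; rewrite /= derivZ -scalerAr.
Qed.

Lemma iter_theta_mul i j n q :
  iter n theta (q * ('X^i * ('X - 1%:P) ^+ j))
  = iter n (twisted_theta i j) q * ('X^i * ('X - 1%:P) ^+ j).
Proof.
elim: n => //= n ->; move: (iter n _ q) => {}q.
rewrite /twisted_theta /theta !derivM.
have hi : 'X * ('X^i)^`() = i%:R * 'X^i :> {poly F}.
  by rewrite mulX_derivXn scaler_nat mulr_natl.
have hj : ('X - 1%:P) * (('X - 1%:P) ^+ j)^`() = j%:R * ('X - 1%:P) ^+ j :> {poly F}.
  rewrite deriv_exp derivXsubC mul1r; case: (j) => [|m]; first by rewrite mulr0 mul0r.
  by rewrite mulrnAr -exprS mulr_natl.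
(* Leibniz's rule, grouped so that each derivative of a power meets its own base; [hi] and [hj] then
   apply without lowering an exponent. *)
transitivity ('X * ('X - 1%:P) * q^`() * ('X^i * ('X - 1%:P) ^+ j)
  + q * (('X * ('X^i)^`()) * ('X - 1%:P) * ('X - 1%:P) ^+ j
  + 'X * 'X^i * (('X - 1%:P) * (('X - 1%:P) ^+ j)^`()))); first by ring.
by rewrite hi hj; ring.
Qed.

(** Each application raises the degree by at most one: differentiation takes back one of the two
    degrees that [X (X - 1)] adds. *)
Lemma size_iter_twisted_theta i j n q :
  (size (iter n (twisted_theta i j) q) <= size q + n)%N.
Proof.
elim: n => [|n IH] /=; first by rewrite addn0.
rewrite addnS -ltnS in IH *; apply: leq_trans IH.
move: (iter n _ q) => {}q.
apply: leq_trans (size_polyD _ _) _; rewrite geq_max; apply/andP; split.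
  have [q0|q0] := eqVneq q^`() 0; first by rewrite /theta q0 mulr0 size_poly0.
  have qn0 : q != 0 by apply: contraNneq q0 => ->; rewrite deriv0.
  rewrite /theta -mulrA -add1n; apply: size_mul_le; first by rewrite size_polyX.
  apply: leq_trans (lt_size_deriv qn0); rewrite -add1n.
  by apply: size_mul_le; rewrite ?size_XsubC.
rewrite -add1n; apply: size_mul_le => //.
apply: leq_trans (size_polyD _ _) _; rewrite geq_max; apply/andP; split.
  rewrite mulr_natl -scaler_nat (leq_trans (size_scale_leq _ _)) //.
  by rewrite size_XsubC.
rewrite mulr_natl -scaler_nat (leq_trans (size_scale_leq _ _)) //.
by rewrite size_polyX.
Qed.

(** From [n] to [n + 1]: by induction [theta f] vanishes to order [n] at [x], hence so does the
    derivative of [f], as [x] is not a root of [X (X - 1)]. A positive multiplicity at most [n < p]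
    is nonzero in [F], so it would drop by exactly one under differentiation; hence that of [f]
    exceeds [n]. *)
Lemma dvdp_XsubC_exp_theta p (x : F) n f :
  p \in [pchar F] -> x != 0 -> x != 1 -> (n <= p)%N ->
  (forall k, (k < n)%N -> root (iter k theta f) x) -> ('X - x%:P) ^+ n %| f.
Proof.
move=> charF x0 x1; elim: n f => [|n IH] f np rt; first by rewrite dvd1p.
have df : ('X - x%:P) ^+ n %| theta f.
  by apply: IH (ltnW np) _ => k kn; rewrite -iterSr; apply: rt.
move: df; rewrite Gauss_dvdpr; last first.
  rewrite coprimep_expl // coprimep_sym coprimep_XsubC rootM rootX root_XsubC.
  by rewrite negb_or x0.
move=> df; have [m [q nq fE]] := multiplicity_XsubC f x.
have [->|f0] := eqVneq f 0; first by rewrite dvdp0.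
rewrite f0 /= in nq.
have [mn|nm] := leqP m n; last by rewrite fE dvdp_mull // dvdp_exp2l.
case: m fE mn => [|m] fE mn.
  by have := rt 0%N isT; rewrite /= fE expr0 mulr1 (negPf nq).
have : ('X - x%:P) ^+ m.+1 %| f^`() by apply: dvdp_trans df; rewrite dvdp_exp2l.
rewrite fE derivM dvdp_addr ?dvdp_mulIr // deriv_exp derivXsubC mul1r /=.
rewrite mulrnAr -mulrnAl exprS dvdp_mul2r ?expf_neq0 ?polyXsubC_eq0 //.
rewrite dvdp_XsubCl rootE hornerMn -mulr_natr mulf_eq0 -rootE (negPf nq) /=.
by rewrite -(dvdn_pcharf charF) gtnNdvd // (leq_ltn_trans mn).
Qed.

End Theta.

(** * Stepanov's method for points with prescribed pairs of powers *)

Section Stepanov.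
Variables (F : finFieldType) (p : nat).
Hypothesis charF : p \in [pchar F].

Definition shifted_powers_in (T : nat) (P : {set F * F}) : {set F} :=
  [set x | [&& x != 0, x != 1 & (x ^+ T, (x - 1) ^+ T) \in P]].

Lemma natr_inj_lt_pchar m n :
  (m < p)%N -> (n < p)%N -> m%:R = n%:R :> F -> m = n.
Proof.
wlog mn : m n / (m <= n)%N => [wl|] mp np mnE.
  by case/orP: (leq_total m n) => mn; [|symmetry]; apply: wl.
have : (p %| n - m)%N by rewrite (dvdn_pcharf charF) natrB // mnE subrr.
by case: (posnP (n - m)) => [h _|h /(dvdn_leq h)]; lia.
Qed.

Section Auxiliary.
Variables T D B : nat.
Hypotheses (DB : (D * B <= T)%N) (TB : (T * B <= p)%N).

Definition aux_monomial (i : 'I_D * 'I_B * 'I_B) : {poly F} :=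
  'X^(i.1.1) * ('X^(T * i.1.2) * ('X - 1%:P) ^+ (T * i.2)).

(* In a vanishing combination the coefficient of the lowest power of [(X-1)^T] is
   divisible by [(X-1)^T], but has at most [D B <= T] monomials. *)
Lemma aux_monomial_free (l : 'I_D * 'I_B * 'I_B -> F) :
  \sum_i l i *: aux_monomial i = 0 -> forall i, l i = 0.
Proof.
pose e (ab : 'I_D * 'I_B) := (ab.1 + T * ab.2)%N.
pose f (c : 'I_B) : {poly F} := \sum_ab l (ab, c) *: 'X^(e ab).
have -> : \sum_i l i *: aux_monomial i = \sum_c f c * (('X - 1%:P) ^+ T) ^+ c.
  rewrite (eq_bigr (fun c => \sum_ab l (ab, c) *: aux_monomial (ab, c))).
    by rewrite exchange_big pair_big /=; apply: eq_bigr => -[ab c] _.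
  move=> c _; rewrite mulr_suml; apply: eq_bigr => ab _.
  by rewrite /aux_monomial /= -scalerAl mulrA -exprD exprM.
(* Each exponent [a + T * b] is below [T * B <= p], so its residue in [F] determines it; as
   [D <= T], division by [T] recovers [a] and [b]. The index itself witnesses [0 < B]. *)
have einj : injective (fun ab => (e ab)%:R : F).
  have DT (ab : 'I_D * 'I_B) : (D <= T)%N.
    by apply: leq_trans DB; apply: leq_pmulr; case: ab.2 => ? /(leq_trans _) ->.
  have ep ab : (e ab < p)%N.
    apply: leq_trans TB; rewrite /e.
    have := DT ab; have := ltn_ord ab.1; have := ltn_ord ab.2.
    by move: (nat_of_ord _) (nat_of_ord _) => b a; nia.
  move=> [a b] [a' b'] /(natr_inj_lt_pchar (ep _) (ep _)).
  rewrite /e /= addnC [RHS]addnC => ee.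
  have aT (k : nat) (i : 'I_D) : ((T * k + i) %/ T)%N = k.
    have iT : (i < T)%N by apply: leq_trans (DT (a, b)).
    by rewrite mulnC divnMDl ?(leq_ltn_trans _ iT) // divn_small ?addn0.
  have bb : b = b' by apply: val_inj; rewrite /= -(aT b a) ee aT.
  by move: ee; rewrite bb => /addnI/val_inj ->.
have f0 c : ('X - 1%:P) ^+ T %| f c -> forall ab, l (ab, c) = 0.
  move=> dv ab; have := @sparse_poly_eq0 F _ e (index_enum _) (fun ab => l (ab, c)).
  move=> /(_ (index_enum_uniq _) (in2W einj)); apply; last exact: mem_index_enum.
  apply: dvdp_trans dv; rewrite dvdp_exp2l //.
  by rewrite -[X in size X]enumT -cardE card_prod !card_ord.
move=> fs [ab c]; apply: (f0).
rewrite (adic_sum_eq0 _ _ fs) ?dvdp0 //; first by rewrite expf_neq0 // polyXsubC_eq0.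
by move=> i /f0 l0; rewrite /f big1 // => ab' _; rewrite l0 scale0r.
Qed.

Lemma size_aux_monomial i : (size (aux_monomial i) <= D + 2 * T * B)%N.
Proof.
have := ltn_ord i.1.1; have := ltn_ord i.1.2; have := ltn_ord i.2.
rewrite /aux_monomial; move: (i.1.1) (i.1.2) (i.2) => a b c cB bB aD.
apply: leq_trans (_ : _ <= a + (T * b + (T * c).+1))%N _; last by nia.
by do 2![apply: size_mul_le; first by rewrite size_polyXn]; rewrite size_exp_XsubC.
Qed.

(* [Psi = \sum_i l i *: aux_monomial i] has to vanish to order [D] at every
   point [x].  On each monomial [theta^n] acts through [twisted_theta^n] on the
   factor [X^a]; replacing [x^T, (x-1)^T] by their values [y, z] and asking the
   resulting polynomial in [x] to be zero identically costs at most [2 D^2]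
   linear equations for each pair [(y, z)], whatever the number of points. *)
Lemma stepanov (P : {set F * F}) :
  (D <= p)%N -> (2 * #|P| * D < B ^ 2)%N ->
  (D * #|shifted_powers_in T P| <= D + 2 * T * B)%N.
Proof.
move=> Dp JDB; have [D0|D0] := posnP D; first by rewrite D0.
pose I : finType := ('I_D * 'I_B * 'I_B)%type.
pose E : finType := ('I_#|P| * 'I_D * 'I_(2 * D))%type.
pose L (i : I) n : {poly F} := iter n (twisted_theta (T * i.1.2) (T * i.2)) 'X^(i.1.1).
pose M (i : I) (e : E) : F := (enum_val e.1.1).1 ^+ i.1.2
   * (enum_val e.1.1).2 ^+ i.2 * (L i e.1.2)`_e.2.
(* There are [D * B^2] unknowns against [2 * #|P| * D^2] equations; [2 * D] coefficients suffice
   because [L i n] has size at most [D + n]. *)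
have EI : (#|E| < #|I|)%N by rewrite !card_prod !card_ord; nia.
have [l [[i0 li0] sys]] := underdetermined_system M EI.
pose Psi := \sum_i l i *: aux_monomial i.
have Psi0 : Psi != 0.
  by apply: contraNneq li0 => /aux_monomial_free ->.
have szPsi : (size Psi <= D + 2 * T * B)%N.
  apply: leq_trans (size_sum _ _ _) _; apply/bigmax_leqP => i _.
  exact: leq_trans (size_scale_leq _ _) (size_aux_monomial i).
pose s := enum (shifted_powers_in T P).
have dvs : (\prod_(x <- s) ('X - x%:P)) ^+ D %| Psi.
  apply: dvdp_prod_XsubC_exp; first exact: enum_uniq.
  move=> x; rewrite mem_enum inE => /and3P[x0 x1 xP].
  apply: (dvdp_XsubC_exp_theta charF) => // n nD.
  rewrite iter_theta_sum rootE horner_sum.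
  rewrite (eq_bigr (fun i : I => \sum_(k < 2 * D)
     x ^+ k * (l i * M i (enum_rank_in xP (x ^+ T, (x - 1) ^+ T), Ordinal nD, k)))).
    rewrite exchange_big big1 //= => k _.
    by rewrite -mulr_sumr sys mulr0.
  move=> i _; rewrite hornerZ iter_theta_mul hornerM /M /= enum_rankK_in //= -/(L i n).
  rewrite (@horner_coef_wide _ (2 * D)); last first.
    apply: leq_trans (size_iter_twisted_theta _ _ _ _) _.
    by rewrite size_polyXn; have := ltn_ord i.1.1; lia.
  rewrite !hornerE /= mulr_sumr !mulr_suml; apply: eq_bigr => k _.
  by rewrite !exprM; ring.
have := dvdp_leq Psi0 dvs; set Q := _ ^+ D => sQ.
have : (size Q).-1 = (#|shifted_powers_in T P| * D)%N.
  by rewrite size_exp size_prod_XsubC /= -cardE.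
by move: sQ szPsi; move: (size Q) (size Psi); lia.
Qed.

End Auxiliary.

(* [B] is the integer part of [(J T)^(1/3)] and [D] that of about [B^2 / (2 J)]. *)
Lemma stepanov_optimized (T : nat) (P : {set F * F}) :
  (0 < #|P|)%N -> (512 * #|P| <= T ^ 2)%N -> (#|P| * T ^ 4 <= p ^ 3)%N ->
  exists2 B, (B ^ 3 <= #|P| * T)%N & (#|shifted_powers_in T P| <= 66 * B ^ 2)%N.
Proof.
set J := #|P| => J0 JT Jp.
have [B B1 B2] : exists2 B, (B ^ 3 <= J * T)%N & (J * T < B.+1 ^ 3)%N.
  have ex0 : exists B, (B ^ 3 <= J * T)%N by exists 0%N.
  have ub B : (B ^ 3 <= J * T)%N -> (B <= J * T)%N.
    by case: B => // B; apply: leq_trans; rewrite -{1}[B.+1]expn1 leq_pexp2l.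
  case: (ex_maxnP ex0 ub) => B B1 Bmax; exists B => //.
  by rewrite ltnNge; apply/negP => /Bmax; rewrite ltnn.
have T0 : (0 < T)%N by rewrite lt0n; apply: contraTneq JT => ->; lia.
have B0 : (0 < B)%N.
  by rewrite lt0n; apply: contraTneq B2 => ->; rewrite exp1n -leqNgt muln_gt0 J0.
have B8 : (J * T < 8 * B ^ 3)%N.
  apply: leq_trans B2 _; rewrite -[8%N]/(2 ^ 3)%N -expnMn leq_exp2r //; lia.
(* Ensures [D > 0], and explains 512: otherwise [(J T)^2 < 64 B^6 <= 64 * 8 J^3 <= (J T)^2]. *)
have JB : (2 * J < B ^ 2)%N.
  rewrite ltnNge; apply/negP => BJ.
  have h1 : ((J * T) ^ 2 < (8 * B ^ 3) ^ 2)%N by rewrite ltn_exp2r.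
  have h2 : ((B ^ 2) ^ 3 <= (2 * J) ^ 3)%N by rewrite leq_exp2r.
  have h3 : (J ^ 2 * (512 * J) <= J ^ 2 * T ^ 2)%N by rewrite leq_mul2l JT orbT.
  by move: h1 h2 h3; rewrite (expnMn J) (expnMn 8) (expnMn 2) -!expnM; lia.
(* The predecessor makes [2 * J * D < B ^ 2] strict, as [stepanov] requires. *)
pose D := ((B ^ 2).-1 %/ (2 * J))%N.
have D1 : (2 * J * D <= (B ^ 2).-1)%N by rewrite mulnC leq_divM.
have D2 : ((B ^ 2).-1 < D.+1 * (2 * J))%N by rewrite ltn_ceil // muln_gt0.
have D0 : (0 < D)%N by rewrite divn_gt0 ?muln_gt0 //; lia.
have DB : (D * B <= T)%N.
  have : (2 * J * D * B <= B ^ 2 * B)%N by rewrite leq_mul2r; apply/orP; right; lia.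
  by rewrite -expnSr => h; rewrite -(leq_pmul2l J0); lia.
have TB : (T * B <= p)%N.
  rewrite -(@leq_exp2r _ _ 3) // expnMn; apply: leq_trans Jp.
  by rewrite -[4%N]/(3 + 1)%N expnD expn1 mulnCA leq_mul2l B1 orbT.
have Dp : (D <= p)%N by nia.
have JDB : (2 * J * D < B ^ 2)%N by lia.
exists B => //; have := stepanov DB TB Dp JDB; set U := #|_| => DU.
(* Multiply [DU] by [4 * J]. With [B^2 <= 4 J D <= 2 B^2] and [J T < 8 B^3] this gives
   [U <= 2 + 64 B^2], whence 66. *)
have h1 : (B ^ 2 <= 4 * J * D)%N by have := leq_pmulr J D0; lia.
have h2 : (B ^ 2 * U <= 4 * J * D * U)%N by rewrite leq_mul2r h1 orbT.
have h3 : (4 * J * (D * U) <= 4 * J * (D + 2 * T * B))%N by rewrite leq_mul2l DU orbT.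
have h4 : (8 * B * (J * T) <= 8 * B * (8 * B ^ 3))%N by rewrite leq_mul2l ltnW ?orbT.
have : (B ^ 2 * U <= B ^ 2 * (2 + 64 * B ^ 2))%N by move: h2 h3 h4; rewrite !expnS; lia.
rewrite leq_pmul2l ?expn_gt0 ?B0 // => UB; apply: leq_trans UB _.
have : (0 < B ^ 2)%N by rewrite expn_gt0 B0.
lia.
Qed.

(** * Roots of unity and the weak-type estimate for fibers *)

Definition roots_of_unity (T : nat) : {set F} := [set u | u ^+ T == 1].

Lemma card_roots_of_unity (T : nat) : (0 < T)%N -> (#|roots_of_unity T| <= T)%N.
Proof.
move=> T0; rewrite cardE; apply: max_unity_roots T0 _ (enum_uniq _).
by apply/allP => u; rewrite mem_enum inE => /eqP uT; apply/unity_rootP.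
Qed.

(** The case of one pair, where [B^3 <= T]. For [T^2 < 512] the trivial bound by [T] suffices, since
    then [T <= 66]. *)
Lemma card_shifted_roots (T : nat) :
  (0 < T)%N -> (T ^ 4 <= p ^ 3)%N ->
  (#|shifted_powers_in T [set (1, 1)%R]| ^ 3 <= 66 ^ 3 * T ^ 2)%N.
Proof.
move=> T0 Tp; have [T512|T512] := leqP 512 (T ^ 2).
  have := @stepanov_optimized T [set (1, 1)%R]; rewrite cards1 muln1 !mul1n.
  move=> /(_ isT T512 Tp)[B B1 UB].
  have /leq_trans -> // : (#|shifted_powers_in T [set (1, 1)%R]| ^ 3
    <= (66 * B ^ 2) ^ 3)%N by rewrite leq_exp2r.
  by rewrite expnMn leq_mul2l -expnM mulnC expnM leq_exp2r ?B1 ?orbT.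
have UT : (#|shifted_powers_in T [set (1, 1)%R]| <= T)%N.
  apply: leq_trans (card_roots_of_unity T0); apply: subset_leq_card.
  by apply/subsetP => x; rewrite !inE xpair_eqE => /and3P[_ _ /andP[]].
have T66 : (T <= 66)%N by rewrite leqNgt; apply/negP => h; nia.
apply: leq_trans (_ : T ^ 3 <= _)%N; first by rewrite leq_exp2r.
by rewrite expnS leq_mul2r (leq_trans T66) ?orbT // -{1}[66%N]expn1 leq_pexp2l.
Qed.

(** Its cardinality is the [nu x] of the overview. *)
Definition fiber (T : nat) (x : F) : {set F} :=
  shifted_powers_in T [set (x ^+ T, (x - 1) ^+ T)].

Definition large_fiber (T t : nat) : {set F} :=
  [set x | [&& x != 0, x != 1 & (t < #|fiber T x|)%N]].

Lemma mem_fiber T x : x != 0 -> x != 1 -> x \in fiber T x.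
Proof. by move=> x0 x1; rewrite !inE x0 x1 eqxx. Qed.

Lemma fiberP T x y :
  reflect [/\ y != 0, y != 1, y ^+ T = x ^+ T & (y - 1) ^+ T = (x - 1) ^+ T]
    (y \in fiber T x).
Proof.
rewrite !inE xpair_eqE; apply: (iffP and3P) => [[-> -> /andP[/eqP -> /eqP ->]]|] //.
by move=> [-> -> -> ->]; rewrite !eqxx.
Qed.

(* For [y] in the fiber of [x], both [u = y / x] and [v = (y - 1) / (x - 1)] are
   T-th roots of unity, and [x = (1 - v) / (u - v)] as soon as [y != x]. *)
Lemma card_large_fiber_sqr T t :
  (0 < T)%N -> (t * #|large_fiber T t| <= T ^ 2)%N.
Proof.
move=> T0; set R := large_fiber T t.
pose W := [set w : F * F | (w.1 \in R) && (w.2 \in fiber T w.1 :\ w.1)].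
have tW : (t * #|R| <= #|W|)%N.
  have -> : #|W| = (\sum_(x in R) #|fiber T x :\ x|)%N.
    rewrite -sum1dep_card.
    rewrite -(pair_big_dep (mem R) (fun x y => y \in fiber T x :\ x) (fun _ _ => 1%N)) /=.
    by apply: eq_bigr => x _; rewrite sum1_card.
  rewrite mulnC -sum_nat_const; apply: leq_sum => x; rewrite inE => /and3P[x0 x1].
  by rewrite (cardsD1 x) mem_fiber.
pose h (w : F * F) := (w.2 / w.1, (w.2 - 1) / (w.1 - 1)).
have WP w : w \in W -> [/\ w.1 != 0, w.1 - 1 != 0, w.2 != w.1,
    w.2 ^+ T = w.1 ^+ T & (w.2 - 1) ^+ T = (w.1 - 1) ^+ T].
  case: w => x y; rewrite inE /= in_setD1 => /andP[]; rewrite inE => /and3P[x0 x1 _].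
  by move=> /andP[yx /fiberP[_ _ yT yT1]]; rewrite subr_eq0.
have hinj : {in W &, injective h}.
  have hE w : w \in W -> let: (u, v) := h w in
      [/\ u - v != 0, w.1 = (1 - v) / (u - v) & w.2 = w.1 * u].
    move=> /WP[]; case: w => x y /= x0 x1 yx _ _.
    have uv : y / x - (y - 1) / (x - 1) = (x - y) / (x * (x - 1)) by field; rewrite x0 x1.
    have xy : x - y != 0 by rewrite subr_eq0 eq_sym.
    have uv0 : y / x - (y - 1) / (x - 1) != 0.
      by rewrite uv mulf_neq0 // invr_neq0 // mulf_neq0.
    by split => //; [rewrite uv|]; field; rewrite ?x0 ?x1 ?xy.
  move=> [x y] [x' y'] /hE + /hE; move=> + + hh; rewrite -hh; case: (h _) => u v /=.
  by move=> [_ -> ->] [_ -> ->].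
apply: leq_trans tW _; rewrite -(card_in_imset hinj).
apply: leq_trans (_ : #|setX (roots_of_unity T) (roots_of_unity T)| <= _)%N.
  apply: subset_leq_card; apply/subsetP => _ /imsetP[w /WP[x0 x1 _ yT yT1] ->].
  by rewrite !inE /= !expr_div_n yT yT1 !divff ?expf_neq0 // eqxx.
by rewrite cardsX leq_mul ?card_roots_of_unity.
Qed.

(** The set [R] is the full preimage under [h] of its image [P], and each pair has more than [t]
    preimages, so [t #|P| <= #|R|]. Stepanov's bound [#|R|^3 <= 66^3 (#|P| T)^2], multiplied by
    [t^2] and divided by [#|R|^2], gives the claim. *)
Lemma card_large_fiber T t :
  (0 < T)%N -> (T ^ 2 <= p)%N ->
  (t ^ 2 * #|large_fiber T t| <= 66 ^ 3 * T ^ 2)%N.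
Proof.
move=> T0 Tp; have tRT := card_large_fiber_sqr t T0.
set R := large_fiber T t in tRT *.
pose h (x : F) := (x ^+ T, (x - 1) ^+ T); pose P := h @: R.
have [P0|P0] := posnP #|P|.
  have -> : #|R| = 0%N; last by rewrite muln0.
  by move: P0 => /eqP; rewrite cards_eq0 imset_eq0 -cards_eq0 => /eqP.
have RE : R = shifted_powers_in T P.
  apply/setP => x; apply/idP/idP => [xR|].
    by have := xR; rewrite !inE => /and3P[-> -> _] /=; apply: imset_f.
  rewrite inE => /and3P[x0 x1 /imsetP[y yR hxy]].
  by move: yR; rewrite !inE x0 x1 /fiber => /and3P[_ _]; rewrite /h in hxy; rewrite hxy.
have tP : (t.+1 * #|P| <= #|R|)%N.
  rewrite -[X in (_ <= X)%N]sum1_card (partition_big_imset h) /= mulnC -sum_nat_const.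
  apply: leq_sum => _ /imsetP[y yR ->]; rewrite sum1dep_card.
  have := yR; rewrite inE => /and3P[_ _ /leq_trans]; apply.
  apply: subset_leq_card; apply/subsetP => x xy; rewrite inE.
  have /fiberP[x0 x1 e1 e2] := xy.
  rewrite inE x0 x1 /fiber e1 e2 /h e1 e2 eqxx andbT.
  by have := yR; rewrite inE => /and3P[_ _].
have [PT|PT] := leqP (512 * #|P|) (T ^ 2).
  have Pp : (#|P| * T ^ 4 <= p ^ 3)%N.
    apply: leq_trans (_ : (T ^ 2) ^ 3 <= _)%N; last by rewrite leq_exp2r.
    by rewrite -expnM -[(2 * 3)%N]/(2 + 4)%N expnD leq_mul2r; apply/orP; right; lia.
  have [B B1] := stepanov_optimized P0 PT Pp; rewrite -RE => RB.
  have R0 : (0 < #|R|)%N by apply: leq_trans tP; rewrite muln_gt0.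
  have h1 : (#|R| ^ 3 <= 66 ^ 3 * (#|P| * T) ^ 2)%N.
    apply: leq_trans (_ : (66 * B ^ 2) ^ 3 <= _)%N; first by rewrite leq_exp2r.
    by rewrite expnMn leq_mul2l -expnM mulnC expnM leq_exp2r ?B1 ?orbT.
  have h2 : (t.+1 ^ 2 * #|P| ^ 2 <= #|R| ^ 2)%N by rewrite -expnMn leq_exp2r.
  have h3 : (t ^ 2 <= t.+1 ^ 2)%N by rewrite leq_exp2r.
  rewrite -(@leq_pmul2l (#|R| ^ 2)) ?expn_gt0 ?R0 //.
  apply: leq_trans (_ : t.+1 ^ 2 * #|R| ^ 3 <= _)%N.
    by rewrite mulnCA -expnSr leq_mul2r h3 orbT.
  apply: leq_trans (_ : t.+1 ^ 2 * (66 ^ 3 * (#|P| * T) ^ 2) <= _)%N.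
    by rewrite leq_mul2l h1 orbT.
  rewrite expnMn mulnCA [in X in (_ <= X)%N]mulnCA leq_mul2l; apply/orP; right.
  by rewrite mulnA leq_mul2r h2 orbT.
(* Here [P] is too large for Stepanov, but [tRT] gives [t (t + 1) #|P| <= T^2 < 512 #|P|], which
   bounds [t]. *)
have t66 : (t <= 66)%N.
  rewrite leqNgt; apply/negP => t_gt.
  have : (t * (t.+1 * #|P|) <= t * #|R|)%N by rewrite leq_mul2l tP orbT.
  have : (66 * 66 * #|P| <= t * t.+1 * #|P|)%N by rewrite leq_mul2r leq_mul ?orbT //; lia.
  by lia.
rewrite -mulnn -mulnA leq_mul //; apply: leq_trans t66 _.
by rewrite -{1}[66%N]expn1 leq_pexp2l.
Qed.

End Stepanov.

(** * Summation, and counting triples by their ratio *)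

(* Induction on [#|X|], removing a point where [f] is minimal: there
   [f^2 #|X| <= K]. *)
Lemma weak_type_sum (I : finType) (X : {set I}) (f : I -> nat) (K : nat) :
  (forall t, (t ^ 2 * #|[set x in X | (t <= f x)%N]| <= K)%N) ->
  ((\sum_(x in X) f x) ^ 2 <= 4 * K * #|X|)%N.
Proof.
move: {2}#|X| (erefl #|X|) => m; elim: m X => [|m IH] X Xm wt.
  by rewrite (cards0_eq Xm) big_set0.
have [x0 x0X] : exists x, x \in X by apply/card_gt0P; rewrite Xm.
pose x := [arg min_(x < x0 in X) f x].
have [xX xmin] : x \in X /\ forall y, y \in X -> (f x <= f y)%N.
  by rewrite /x; case: (arg_minnP f x0X).
have fxK : (f x ^ 2 * m.+1 <= K)%N.
  have XE : X = [set y in X | (f x <= f y)%N].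
    by apply/setP => y; rewrite inE andb_idr // => /xmin.
  by rewrite -Xm {1}XE.
have Xx : #|X :\ x| = m by move: Xm; rewrite (cardsD1 x) xX => -[].
have := IH (X :\ x) Xx; rewrite Xx => /(_ _) S2.
have {}S2 : ((\sum_(y in X :\ x) f y) ^ 2 <= 4 * K * m)%N.
  apply: S2 => t; apply: leq_trans (wt t); rewrite leq_mul2l.
  apply/orP; right; apply: subset_leq_card; apply/subsetP => y.
  by rewrite !inE => /andP[/andP[_ ->] ->].
rewrite (big_setD1 x) //= Xm; move: (\sum_(_ in _) _)%N (f x) S2 fxK => S a S2 aK.
suff Sa : (2 * S * a + a ^ 2 <= 4 * K)%N by rewrite !expnS !expn0 in S2 Sa *; lia.
rewrite leqNgt; apply/negP => Sa.
have aK' : (a ^ 2 <= K)%N by apply: leq_trans aK; rewrite leq_pmulr.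
(* The negated bound reads [d < 2 S a]. Expanding [(d + a^2)^2 (m + 1) = 16 K^2 (m + 1)] then bounds
   it strictly by [16 K^2 m + 8 K^2], which is absurd. *)
pose d := (4 * K - a ^ 2)%N.
have dE : (d + a ^ 2 = 4 * K)%N by rewrite /d; lia.
have h1 : (d ^ 2 * m.+1 < (2 * S * a) ^ 2 * m.+1)%N.
  by rewrite ltn_mul2r /= ltn_exp2r //; lia.
have h2 : (S ^ 2 * (a ^ 2 * m.+1) <= 4 * K * m * K)%N by rewrite leq_mul.
have h3 : ((2 * d + a ^ 2) * (a ^ 2 * m.+1) <= 8 * K * K)%N by rewrite leq_mul //; lia.
have h4 : ((d + a ^ 2) ^ 2 * m.+1 = (4 * K) ^ 2 * m.+1)%N by rewrite dE.
by move: h1 h2 h3 h4; rewrite !expnS !expn0; lia.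
Qed.

Lemma card_distinct_triples (I : finType) (A : {set I}) :
  #|[set t : I * I * I | [&& t.1.1 \in A, t.1.2 \in A :\ t.1.1
                           & t.2 \in A :\ t.1.1 :\ t.1.2]]|
  = (#|A| * #|A|.-1 * #|A|.-2)%N.
Proof.
rewrite -sum1dep_card.
transitivity (\sum_(a in A) \sum_(b in A :\ a) \sum_(c in A :\ a :\ b) 1)%N.
  rewrite pair_big_dep pair_big_dep /=.
  by apply: eq_bigl => t; rewrite andbA.
rewrite (eq_bigr (fun _ => #|A|.-1 * #|A|.-2)%N) ?sum_nat_const ?mulnA // => a aA.
have Aa : #|A :\ a| = #|A|.-1 by rewrite (cardsD1 a A) aA.
rewrite (eq_bigr (fun _ => #|A|.-2)) ?sum_nat_const ?Aa // => b bA.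
by rewrite sum1_card -Aa (cardsD1 b (A :\ a)) bA.
Qed.

Section Subgroups.
Variables (F : finFieldType) (p : nat).
Hypothesis charF : p \in [pchar F].

(* If [(c - b) / (a - b) = x] and [a, b, c] are translates by [s] of T-th roots
   of unity, then [x (a - s) / (c - s)] is a point of the fiber of [x] other
   than [x]. *)
Lemma card_distinct_triples_le (T : nat) (A X : {set F}) (s : F) :
  (0 < T)%N -> {in A, forall a, (a - s) ^+ T = 1} ->
  {in A & A & A, forall a b c, a != b -> c != a -> c != b -> (c - b) / (a - b) \in X} ->
  (#|A| * #|A|.-1 * #|A|.-2 <= T * \sum_(x in X) (#|fiber T x|).-1)%N.
Proof.
move=> T0 AT AX; rewrite -card_distinct_triples; set W := [set t | _].
pose r (t : F * F * F) := (t.2 - t.1.2) / (t.1.1 - t.1.2).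
have WP t : t \in W -> [/\ [/\ t.1.1 \in A, t.1.2 \in A & t.2 \in A],
    t.1.1 != t.1.2, t.2 != t.1.1 & t.2 != t.1.2].
  rewrite !inE => /and3P[-> /andP[ba ->] /and3P[-> -> ->]].
  by rewrite eq_sym ba.
have WX t : t \in W -> r t \in X by move=> /WP[[? ? ?] ? ? ?]; apply: AX.
rewrite -sum1_card (partition_big r (mem X)) //= big_distrr /=.
apply: leq_sum => x _; rewrite sum1dep_card.
set Wx := [set t | _]; pose h (t : F * F * F) := (t.2 - s, x * (t.1.1 - s) / (t.2 - s)).
have sA a : a \in A -> a - s != 0.
  by move=> /AT; apply: contra_eqN => /eqP ->; rewrite expr0n gtn_eqF // eq_sym oner_eq0.
have WxP t : t \in Wx -> [/\ t.1.1 \in A, t.1.2 \in A, t.2 \in A, t.2 != t.1.1 &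
    [/\ x != 0, x != 1 & x * (t.1.1 - t.1.2) = t.2 - t.1.2]].
  rewrite inE => /andP[/WP[[aA bA cA] ab ca cb] /eqP rx]; split => //.
  have ab0 : t.1.1 - t.1.2 != 0 by rewrite subr_eq0.
  have xE : x * (t.1.1 - t.1.2) = t.2 - t.1.2 by rewrite -rx /r mulfVK.
  split => //; apply/eqP => x0; move: xE; rewrite x0 ?mul0r ?mul1r => /eqP.
    by rewrite eq_sym subr_eq0 (negPf cb).
  by rewrite subr_eq addrNK eq_sym (negPf ca).
have hinj : {in Wx &, injective h}.
  move=> [[a b] c] [[a' b'] c'] /WxP/= [_ _ cA _ [x0 x1 xE]] /WxP/= [_ _ _ _ [_ _ xE']].
  move=> [/addIr cc]; rewrite -{}cc in xE' *.
  move=> /(mulIf (invr_neq0 (sA _ cA)))/(mulfI x0)/addIr aa.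
  rewrite -{}aa in xE' *; congr (_, _, _); apply/eqP.
  have : (1 - x) * (b - b') = 0.
    transitivity ((x * (a - b) - (c - b)) - (x * (a - b') - (c - b'))); first by ring.
    by rewrite xE xE' !subrr.
  by move/eqP; rewrite mulf_eq0 subr_eq0 eq_sym (negPf x1) subr_eq0.
rewrite -(card_in_imset hinj).
have [x0|] := boolP ((x != 0) && (x != 1)); last first.
  move=> x01; have -> : h @: Wx = set0; last by rewrite cards0.
  apply/setP => z; rewrite inE; apply/negP => /imsetP[t /WxP[_ _ _ _ [x0 x1 _]] _].
  by move: x01; rewrite x0 x1.
move/andP: x0 => [x0 x1].
apply: leq_trans (_ : #|setX (roots_of_unity F T) (fiber T x :\ x)| <= _)%N.
  apply: subset_leq_card; apply/subsetP => _ /imsetP[t tW ->].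
  have [aA bA cA ca [_ _ xE]] := WxP _ tW.
  have c0 := sA _ cA; have x10 : x - 1 != 0 by rewrite subr_eq0.
  (* Rewriting [x (a - b) = c - b] around [s] gives [x (a - s) - (c - s) = (x - 1) (b - s)]; this is
     where [b] being in the translate enters. *)
  have eq1 : x * (t.1.1 - s) / (t.2 - s) - 1 = (x - 1) * (t.1.2 - s) / (t.2 - s).
    apply: (mulIf c0); rewrite mulrBl !mulfVK // mul1r.
    apply/eqP; rewrite -subr_eq0; apply/eqP.
    by rewrite -[RHS](subrr (t.2 - t.1.2)) -{1}xE; ring.
  rewrite in_setX in_setD1 inE /= AT // eqxx /=; apply/andP; split.
    rewrite -[X in _ != X](mulfK c0) (inj_eq (mulIf (invr_neq0 c0))).
    by rewrite (inj_eq (mulfI x0)) (inj_eq (addIr _)) eq_sym.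
  apply/fiberP; split; last 2 first.
  - by rewrite !expr_div_n exprMn !AT // mulr1 divr1.
  - by rewrite eq1 !expr_div_n exprMn !AT // mulr1 divr1.
  - by rewrite !mulf_neq0 ?invr_neq0 ?sA.
  by rewrite -subr_eq0 eq1 !mulf_neq0 ?invr_neq0 ?sA.
rewrite cardsX leq_mul ?card_roots_of_unity //.
by rewrite [X in (_ <= X.-1)%N](cardsD1 x) mem_fiber.
Qed.

(* [K] stands for [66 ^ 3], which unification would otherwise expand in unary. *)
Lemma card_distinct_pow6_le (K T g : nat) (A : {set F}) (s xi : F) :
  (66 ^ 3 <= K)%N ->
  (0 < T)%N -> (0 < g)%N -> (T ^ 2 <= p)%N -> (g ^ 4 <= p ^ 3)%N ->
  {in A, forall a, (a - s) ^+ T = 1} -> xi != 0 ->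
  {in A &, forall a b, a != b -> ((a - b) / xi) ^+ g = 1} ->
  ((#|A| * #|A|.-1 * #|A|.-2) ^ 6
     <= (4 * K) ^ 3 * K * T ^ 12 * g ^ 2)%N.
Proof.
move=> K66 T0 g0 Tp gp AT xi0 AG.
pose X := shifted_powers_in g [set (1, 1) : F * F].
have AX : {in A & A & A, forall a b c, a != b -> c != a -> c != b ->
    (c - b) / (a - b) \in X}.
  move=> a b c aA bA cA ab ca cb; have ab0 : a - b != 0 by rewrite subr_eq0.
  have quo x y : x != y -> x \in A -> y \in A -> ((x - y) / (a - b)) ^+ g = 1.
    move=> xy xA yA; rewrite -[x - y](divfK xi0) -[a - b](divfK xi0).
    by rewrite -mulf_div divff // mulr1 expr_div_n !AG // divr1.
  have quo1 : (c - b) / (a - b) - 1 = (c - a) / (a - b) by field.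
  rewrite inE quo1 !quo // set11 andbT mulf_neq0 ?invr_neq0 ?subr_eq0 //=.
  by rewrite -subr_eq0 quo1 mulf_neq0 ?invr_neq0 // subr_eq0.
have XK : (#|X| ^ 3 <= K * g ^ 2)%N.
  by apply: leq_trans (card_shifted_roots charF g0 gp) _; rewrite leq_mul2r K66 orbT.
have XT t : (t ^ 2 * #|large_fiber F T t| <= K * T ^ 2)%N.
  by apply: leq_trans (card_large_fiber charF t T0 Tp) _; rewrite leq_mul2r K66 orbT.
have := card_distinct_triples_le T0 AT AX.
have := @weak_type_sum F X (fun x => #|fiber T x|.-1) (K * T ^ 2).
set Q := (_ * _)%N; set S := (\sum_(x in X) _)%N => wt QT.
have {}wt : (S ^ 2 <= 4 * (K * T ^ 2) * #|X|)%N.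
  (* For positive [t], [t <= nu x - 1] means [t < nu x], the condition of [large_fiber]; at [t = 0]
     the factor [t^2] vanishes. *)
  apply: wt => -[|t]; first by rewrite exp0n // mul0n.
  apply: leq_trans (XT t.+1).
  rewrite leq_mul2l subset_leq_card ?orbT //; apply/subsetP => x.
  by rewrite !inE -!andbA ltn_predRL => /and5P[-> -> _ _ ->].
(* Sixth powers clear both the square root in the bound for [S] and the cube root in the bound for
   [#|X|]. *)
apply: leq_trans (_ : (T * S) ^ 6 <= _)%N; first by rewrite leq_exp2r.
rewrite expnMn (expnM S 2 3).
apply: leq_trans (_ : T ^ 6 * (4 * (K * T ^ 2) * #|X|) ^ 3 <= _)%N.
  by rewrite leq_mul2l leq_exp2r ?wt ?orbT.
have -> : (T ^ 6 * (4 * (K * T ^ 2) * #|X|) ^ 3 = (4 * K) ^ 3 * T ^ 12 * #|X| ^ 3)%N.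
  by ring.
apply: leq_trans (_ : (4 * K) ^ 3 * T ^ 12 * (K * g ^ 2) <= _)%N.
  by rewrite leq_mul2l XK orbT.
by rewrite mulnACA !mulnA.
Qed.

End Subgroups.

(** For [M >= 3] one has [M^3 <= 5 M (M - 1) (M - 2)], which turns the count of triples into a power
    of [#|A|]; the summand [2 ^ 18] of the constant covers [M <= 2]. *)
Lemma card_pow18_le : exists C : nat, forall (F : finFieldType) (p : nat),
  p \in [pchar F] -> forall (T g : nat) (A : {set F}) (s xi : F),
  (0 < T)%N -> (0 < g)%N -> (T ^ 2 <= p)%N -> (g ^ 4 <= p ^ 3)%N ->
  {in A, forall a, (a - s) ^+ T = 1} -> xi != 0 ->
  {in A &, forall a b, a != b -> ((a - b) / xi) ^+ g = 1} ->
  (#|A| ^ 18 <= C * T ^ 12 * g ^ 2)%N.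
Proof.
have [K K66] : exists K, (66 ^ 3 <= K)%N.
  by eexists; apply: leqnn.
exists (5 ^ 6 * ((4 * K) ^ 3 * K) + 2 ^ 18)%N.
move=> F p charF T g A s xi T0 g0 Tp gp AT xi0 AG.
have := card_distinct_pow6_le charF K66 T0 g0 Tp gp AT xi0 AG.
move: ((4 * K) ^ 3 * K)%N #|A| => C M MC.
have [M2|M3] := leqP M 2.
  apply: leq_trans (_ : 2 ^ 18 <= _)%N; first by rewrite leq_exp2r.
  rewrite -mulnA; apply: leq_trans (_ : (5 ^ 6 * C + 2 ^ 18) * 1 <= _)%N.
    by rewrite muln1 leq_addl.
  by rewrite leq_mul2l muln_gt0 !expn_gt0 T0 g0 orbT.
apply: leq_trans (_ : (5 * (M * M.-1 * M.-2)) ^ 6 <= _)%N.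
  rewrite (expnM M 3 6) leq_exp2r //.
  by case: M M3 {MC} => [|[|[|m]]] // _; rewrite /= !expnS expn0; nia.
rewrite expnMn; apply: leq_trans (_ : 5 ^ 6 * (C * T ^ 12 * g ^ 2) <= _)%N.
  by rewrite leq_mul2l MC orbT.
by move: (5 ^ 6)%N (2 ^ 18)%N => u v; rewrite !mulnDl !mulnA leq_addr.
Qed.

(* Imported only here: [classical_sets] shadows the names of the [finset] library. *)
From mathcomp Require Import all_classical all_reals all_analysis.
Import Order.TTheory GRing.Theory Num.Theory.
Local Open Scope ring_scope.

(** * Subgroups of [F_p^*] as power equations, and the final real bounds *)

Lemma elts_expr (p : nat) (A : {group {unit 'F_p}}) (x : 'F_p) :
  x \in elts A -> x ^+ #|A| = 1.
Proof.
move=> /imsetP[u uA ->]; rewrite -FinRing.val_unitX.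
by have /eqP -> : (u ^+ #|A| == 1)%g by rewrite -order_dvdn order_dvdG.
Qed.

Lemma translate_expr (p : nat) (A : {group {unit 'F_p}}) (A' : {set 'F_p}) (s : 'F_p) :
  A' \subset translate (elts A) s -> {in A', forall a, (a - s) ^+ #|A| = 1}.
Proof.
move=> /fintype.subsetP sA a /sA /imsetP[x /elts_expr xA ->].
by rewrite addrK.
Qed.

Lemma diffset_expr (p : nat) (G : {group {unit 'F_p}}) (A : {set 'F_p}) (xi : 'F_p) :
  xi != 0 -> diffset A \subset 0 |: dilate xi (elts G) ->
  {in A &, forall a b, a != b -> ((a - b) / xi) ^+ #|G| = 1}.
Proof.
move=> xi0 /fintype.subsetP sG a b aA bA ab.
have : a - b \in diffset A by apply: imset2_f.
move=> /sG; rewrite in_setU1 subr_eq0 (negPf ab) => /imsetP[x /elts_expr xG ->].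
by rewrite mulrC mulKf.
Qed.

Lemma card_elts (p : nat) (A : {group {unit 'F_p}}) : #|elts A| = #|A|.
Proof. by rewrite card_imset //; apply: val_inj. Qed.

Theorem theorem8 (R : realType) :
  exists c : R, 0 < c /\
  forall (p : nat), prime p ->
  forall (A G : {group {unit 'F_p}}),
    (#|A|%:R : R) < Num.sqrt (p%:R : R) ->
    (#|G|%:R : R) < powR (p%:R : R) (3 / 4) ->
    (2 <= #|A|)%N ->
    (forall (A' : {set 'F_p}) (s xi : 'F_p),
       A' \subset translate (elts A) s ->
       xi != 0 ->
       diffset A' \subset 0 |: dilate xi (elts G) ->
       (#|A'|%:R : R) ^+ 6
         <= c * (#|A|%:R : R) ^+ 4 * powR (#|G|%:R : R) (2 / 3) * ln (#|A|%:R : R))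
    /\
    (forall xi : 'F_p,
       xi != 0 ->
       diffset (elts A) \subset 0 |: dilate xi (elts G) ->
       (#|A|%:R : R) <= c * powR (#|G|%:R : R) (1 / 3)
                          * Num.sqrt (ln (#|G|%:R : R))).
Proof.
have [C cardC] := card_pow18_le.
(* The successor gives [c0 >= 1], so [c0] is at most its square and its cube when roots are
   taken. *)
pose c0 : R := C.+1%:R.
have c01 : 1 <= c0 by rewrite ler1n.
have ln2 : 0 < ln (2 : R) by rewrite ln_gt0 // ltr1n.
have sln2 : 0 < Num.sqrt (ln (2 : R)) by rewrite sqrtr_gt0.
(* Chosen so that [c * ln n] and [c * sqrt (ln n)] are both at least [c0] for every [n >= 2]. *)
pose c := c0 * ((ln 2)^-1 + (Num.sqrt (ln 2))^-1).
have c_gt0 : 0 < c by rewrite mulr_gt0 ?addr_gt0 ?invr_gt0 // (lt_le_trans _ c01).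
have c_ge (n : nat) : (2 <= n)%N ->
    c0 <= c * ln (n%:R : R) /\ c0 <= c * Num.sqrt (ln (n%:R : R)).
  move=> n2; have lnn : ln (2 : R) <= ln n%:R.
    by rewrite ler_ln ?posrE ?ltr0n ?ler_nat //; lia.
  have slnn : Num.sqrt (ln (2 : R)) <= Num.sqrt (ln n%:R).
    by rewrite ler_sqrt // (le_trans (ltW ln2)).
  have c00 : 0 <= c0 by apply: le_trans c01.
  have inv (l L : R) : 0 < l -> l <= L -> 1 <= l^-1 * L.
    by move=> l0 lL; rewrite mulrC ler_pdivlMr ?mul1r.
  split; rewrite /c -mulrA ler_peMr // mulrDl.
    apply: le_trans (inv _ _ ln2 lnn) _.
    by rewrite lerDl mulr_ge0 ?invr_ge0 ?sqrtr_ge0 // (le_trans (ltW ln2)).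
  apply: le_trans (inv _ _ sln2 slnn) _.
  by rewrite lerDr mulr_ge0 ?invr_ge0 ?sqrtr_ge0 // ltW.
exists c; split=> // p pr A G Ap Gp A2.
have charF := pchar_Fp pr.
have p0 : 0 <= (p%:R : R) by [].
have A2p : (#|A| ^ 2 <= p)%N.
  rewrite -(ler_nat R) natrX -[leRHS]sqr_sqrtr //.
  by rewrite ler_pXn2r ?nnegrE ?sqrtr_ge0 // ltW.
have G4p : (#|G| ^ 4 <= p ^ 3)%N.
  rewrite -(ler_nat R) !natrX -(powR_mulrn 3) //.
  have -> : 3%:R = 3 / 4 * 4%:R :> R by field.
  rewrite powRrM powR_mulrn ?powR_ge0 //.
  by rewrite ler_pXn2r ?nnegrE ?powR_ge0 // ltW.
have A0 : (0 < #|A|)%N by apply: leq_trans A2.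
have G0 : (0 < #|G|)%N by apply: cardG_gt0.
set g : R := #|G|%:R; set a : R := #|A|%:R.
have g0 : 0 <= g by apply: ler0n.
have a0 : 0 < a by rewrite ltr0n.
have main (A' : {set 'F_p}) (s xi : 'F_p) : A' \subset translate (elts A) s ->
    xi != 0 -> diffset A' \subset 0 |: dilate xi (elts G) ->
    (#|A'|%:R : R) ^+ 6 <= c0 * a ^+ 4 * g `^ (2 / 3).
  move=> /translate_expr AT xi0 /(diffset_expr xi0) AG.
  have := cardC _ _ charF _ _ _ _ _ A0 G0 A2p G4p AT xi0 AG.
  rewrite -(ler_nat R) natrX [leRHS]natrM [(C * _)%:R]natrM !natrX -/g -/a => bound.
  rewrite -(@ler_pXn2r _ 3) ?nnegrE ?mulr_ge0 ?exprn_ge0 ?powR_ge0 ?ler0n //.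
  rewrite -exprM; apply: le_trans bound _.
  rewrite exprMn [(c0 * _) ^+ 3]exprMn -exprM.
  rewrite -[(g `^ _) ^+ 3]powR_mulrn ?powR_ge0 // -powRrM.
  have -> : 2 / 3 * 3%:R = 2%:R :> R by field.
  rewrite powR_mulrn //; apply: ler_wpM2r; first by rewrite exprn_ge0.
  apply: ler_wpM2r; first by rewrite exprn_ge0 ?ltW.
  apply: le_trans (_ : c0 <= _); first by rewrite ler_nat.
  by rewrite -{1}[c0]expr1 ler_weXn2l.
split=> [A' s xi AT xi0 AG|xi xi0 AG].
  apply: le_trans (main A' s xi AT xi0 AG) _.
  have [h _] := c_ge _ A2.
  have -> : c * a ^+ 4 * g `^ (2 / 3) * ln a = c * ln a * (a ^+ 4 * g `^ (2 / 3)) by ring.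
  by rewrite -mulrA ler_wpM2r // mulr_ge0 ?powR_ge0 // exprn_ge0 ?ltW.
have AT : elts A \subset translate (elts A) 0.
  by apply/fintype.subsetP => x xA; apply/imsetP; exists x; rewrite ?addr0.
(* Needed as [ln 1 = 0]. If [G] were trivial, [x - y] and [y - x] would both equal [xi], forcing
   [p = 2], against [4 <= #|A|^2 <= p]. *)
have G2 : (2 <= #|G|)%N.
  rewrite ltnNge; apply/negP => G1; have {}G1 : #|G| = 1%N.
    by apply/eqP; rewrite eqn_leq G1 G0.
  have /card_gt1P[x [y [xA yA xy]]] : (1 < #|elts A|)%N by rewrite card_elts.
  have AG' := diffset_expr xi0 AG; rewrite G1 in AG'.
  have := AG' _ _ xA yA xy; have := AG' _ _ yA xA; rewrite eq_sym => /(_ xy).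
  rewrite !expr1 => /divr1_eq yx /divr1_eq xyE.
  have : (2%:R : 'F_p) == 0.
    by rewrite -(mulrI_eq0 _ (mulfI xi0)) mulr_natr mulr2n -{1}yx -xyE; apply/eqP; ring.
  rewrite -(dvdn_pcharf charF) => /(@dvdn_leq p 2 isT) p2.
  have : (2 ^ 2 <= 2)%N by apply: leq_trans (leq_trans A2p p2); rewrite leq_exp2r.
  by [].
(* The bound [main] for [A' = A] and [s = 0], divided by [a^4]. *)
have a2 : a ^+ 2 <= c0 * g `^ (2 / 3).
  rewrite -(ler_pM2r (exprn_gt0 4 a0)) -exprD [leRHS]mulrAC.
  by have := main _ _ _ AT xi0 AG; rewrite card_elts.
have [_ h] := c_ge _ G2.
apply: le_trans (_ : c0 * g `^ (1 / 3) <= _); last first.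
  by rewrite [leRHS]mulrAC ler_wpM2r ?powR_ge0.
rewrite -(@ler_pXn2r _ 2) ?nnegrE ?mulr_ge0 ?powR_ge0 ?(le_trans _ c01) //.
apply: le_trans a2 _; rewrite exprMn -[(g `^ _) ^+ 2]powR_mulrn ?powR_ge0 // -powRrM.
have -> : 1 / 3 * 2%:R = 2 / 3 :> R by field.
by rewrite ler_wpM2r ?powR_ge0 // -{1}[c0]expr1 ler_weXn2l.
Qed.
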